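(* Let $f(x)\in\mathbb{Q}[x]$ be an irreducible polynomial of prime degree $p\ge 5$, and let $r=2s$ be the number of non-real roots of $f(x)$ in $\mathbb{C}$, where $s\ge 1$. If $$s\,\bigl(s\log s+2\log s+3\bigr)\le p,$$ then $\mathrm{Gal}(f)=A_p$ or $\mathrm{Gal}(f)=S_p$.
   Context: $\mathrm{Gal}(f)$ denotes the Galois group over $\mathbb{Q}$ of the splitting field of $f$, regarded as a permutation group on the $p$ roots of $f$, hence as a subgroup of $S_p$ (determined up to conjugacy). The number of non-real roots is even because complex conjugation permutes them in pairs without fixed points. Here $\log$ is the natural logarithm. *)

(* Defs.v *)
From HB Require Import structures.
From mathcomp Require Import all_boot all_order all_algebra.
From mathcomp Require Import all_fingroup all_solvable all_field.
From mathcomp Require Import complex.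
From mathcomp Require Import all_classical all_reals all_analysis.

Set Implicit Arguments.
Unset Strict Implicit.
Unset Printing Implicit Defensive.

Import Order.TTheory GRing.Theory Num.Theory.

Local Open Scope ring_scope.
Local Open Scope classical_set_scope.

Definition nonreal_roots (R : realType) (f : {poly rat}) : set R[i] :=
  [set z | root (map_poly (ratr : rat -> R[i]) f) z /\ complex.Im z != 0].

Arguments nonreal_roots : clear implicits.

(* [rs] lists each root of [f] in [L] exactly once, i.e. it is a labelling of
   the roots by ['I_n]. *)
Definition root_labelling (L : fieldExtType rat) (f : {poly rat})
    (n : nat) (rs : n.-tuple L) : Prop :=
  uniq rs /\ forall z : L, (z \in rs) = root (map_poly (in_alg L) f) z.

(* The image of the automorphism group of [L] over [rat] in ['S_n], through the
   labelling [rs]: [s] belongs to it when some [g] sends the [i]-th root to the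
   [s i]-th root for all [i]. Another labelling gives a conjugate subgroup. *)
Definition gal_perm (L : splittingFieldType rat) (n : nat)
    (rs : n.-tuple L) : {set 'S_n} :=
  [set s : 'S_n | [exists g in 'Gal({:L} / 1)%g,
    [forall i : 'I_n, g (tnth rs i) == tnth rs (s i)]]]%SET.

(* Main.v *)
Require Import Defs.
From HB Require Import structures.
From mathcomp Require Import all_boot all_order all_algebra.
From mathcomp Require Import all_fingroup all_solvable all_field.
From mathcomp Require Import complex.
From mathcomp Require Import all_classical all_reals all_analysis.
From mathcomp Require Import zify ring lra.

Set Implicit Arguments.
Unset Strict Implicit.
Unset Printing Implicit Defensive.

Import Order.TTheory GRing.Theory Num.Theory.

Local Open Scope ring_scope.

(* The Galois group G, acting on the p roots, is transitive, and complex
   conjugation gives an element of G moving exactly 2s points. By Burnside's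
   theorem on groups of prime degree, G is 2-transitive or consists of affine maps
   of F_p; in the affine case nonidentity elements fix at most one point, so
   p <= 2s + 1, which the hypothesis on s excludes.
   Burnside's theorem is proved by representing permutations of F_p as
   polynomials: if G is not 2-transitive, each of them preserves a difference set
   D, and comparing degrees in sum_(d in D) (q(x + d) - q(x)) forces degree 1.
   If G is 2-transitive, let t have minimal degree m in G, with support S. If
   m <= 3 then t is a transposition or a 3-cycle and G contains the alternating
   group. Otherwise, for g in G, either t commutes with its conjugate t^g, or the
   commutator moves at least m points while it moves at most 3 |S :&: g S|. Each
   case bounds |S :&: g S| (|S :&: g S| - 1) from below; averaging over g, which
   by 2-transitivity involves only pairs of points, gives p - 1 <= (m - 1)^2 and
   roughly p <= 4m. As m <= 2s, this contradicts the hypothesis on s. *)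

(** * Alternating groups from small supports *)

Definition moved (T : finType) (t : {perm T}) : {set T} := [set x | t x != x]%SET.

Definition double_transitive (T : finType) (G : {group {perm T}}) : Prop :=
  forall a b c d, a != b -> c != d -> exists2 g, g \in G & g a = c /\ g b = d.

Section AlternatingGroup.

Local Open Scope group_scope.

Variables (T : finType) (G : {group {perm T}}).
Implicit Types (a b c d : T) (s t : {perm T}).

(** Products act from left to right, so for distinct points this is the cycle a -> b -> c -> a. *)
Definition cyc3 a b c : {perm T} := tperm a b * tperm a c.

Lemma cyc3J a b c s : cyc3 a b c ^ s = cyc3 (s a) (s b) (s c).
Proof. by rewrite conjMg !tpermJ. Qed.

Lemma cyc3V a b c : (cyc3 a b c)^-1 = cyc3 a c b.
Proof. by rewrite invMg !tpermV. Qed.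

Lemma cyc3_rot a b c : a != b -> a != c -> b != c -> cyc3 b c a = cyc3 a b c.
Proof.
by move=> ab ac bc; rewrite /cyc3 conjgC tpermJ tpermL tpermD 1?tpermC.
Qed.

Lemma cyc3E1 a b c : a != b -> b != c -> cyc3 a b c a = b.
Proof. by move=> ab bc; rewrite permM tpermL tpermD // eq_sym. Qed.

Lemma cyc3E2 a b c : cyc3 a b c b = c.
Proof. by rewrite permM tpermR tpermL. Qed.

Lemma cyc3E3 a b c : a != c -> b != c -> cyc3 a b c c = a.
Proof. by move=> ac bc; rewrite permM [tperm a b c]tpermD // tpermR. Qed.

Lemma cyc3D a b c x : a != x -> b != x -> c != x -> cyc3 a b c x = x.
Proof. by move=> ax bx cx; rewrite permM [tperm a b x]tpermD // tpermD. Qed.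

(** An even permutation is a product of pairs of transpositions, and (a b)(c d) = (a b)(a c) (a c)(c
    d), where each factor is trivial or a 3-cycle. *)
Lemma Alt_sub_cyc3 :
    (forall a b c, a != b -> a != c -> b != c -> cyc3 a b c \in G) ->
  'Alt_T \subset G.
Proof.
move=> G3.
have share a b c : a != b -> a != c -> tperm a b * tperm a c \in G.
  move=> ab ac; have [->|bc] := eqVneq b c; last exact: G3.
  by rewrite -{1}tpermV mulVg group1.
have pairs a b c d : a != b -> c != d -> tperm a b * tperm c d \in G.
  move=> ab cd; have [ac|ac] := eqVneq a c; first by subst c; exact: share.
  rewrite -[tperm a b]mulg1 -(mulVg (tperm a c)) tpermV -!mulgA mulgA.
  by rewrite groupM ?share // tpermC share // eq_sym.
apply/fintype.subsetP=> s; rewrite Alt_even.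
have [ts ->] := prod_tpermP s => dts.
rewrite odd_perm_prod // => ev.
have [n] := ubnP (size ts); elim: n ts dts ev => // n IHn ts dts ev.
case: ts dts ev => [|x [|y ts]] //= dts ev; first by rewrite big_nil group1.
case/and3P: dts => dx dy dts; rewrite negbK in ev.
rewrite !big_cons mulgA !ltnS => lt; apply: groupM; first exact: pairs.
by apply: IHn => //; apply: leq_trans lt.
Qed.

Hypothesis G2 : double_transitive G.

(** Conjugates of the given cycle provide, for each ordered pair of points, some 3-cycle of [G]
    sending the first to the second. Combining those for (a, b) and (b, d) produces every
    [cyc3 a b d]. *)
Lemma Alt_sub_one_cyc3 a b c :
  a != b -> a != c -> b != c -> cyc3 a b c \in G -> 'Alt_T \subset G.
Proof.
move=> ab0 ac0 bc0 G3.
have ex3 x y : x != y -> exists z, [/\ x != z, y != z & cyc3 x y z \in G].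
  move=> xy; have [g Gg [<- <-]] := G2 ab0 xy.
  by exists (g c); rewrite !(inj_eq perm_inj) -cyc3J groupJ.
apply: Alt_sub_cyc3 => {ab0 ac0 bc0 G3}{}a {}b d ab ad bd.
have [{}c [ac bc Gx]] := ex3 _ _ ab; have [e [be de Gy]] := ex3 _ _ bd.
have [<- //|cd] := eqVneq c d.
have [ea|ae] := eqVneq a e.
  by rewrite -cyc3_rot // [in cyc3 _ _ a]ea.
have [ec|ce] := eqVneq c e.
  rewrite -cyc3V groupV; have: cyc3 a b c ^ cyc3 b d e \in G by rewrite groupJ.
  rewrite -ec in de be *; rewrite cyc3J cyc3E1 // cyc3E3 // cyc3D //.
  - by rewrite eq_sym.
  - by rewrite eq_sym.
  - by rewrite eq_sym.
(* The five points are now distinct. The inner conjugate is [cyc3 c d e], which carries [cyc3 a b c]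
   to [cyc3 a b d]. *)
have: cyc3 a b c ^ (cyc3 b d e ^ cyc3 a b c) \in G by rewrite !groupJ.
rewrite [X in _ ^ X]cyc3J cyc3E2 !(@cyc3D a b c) // cyc3J cyc3E1 // !cyc3D //.
all: by rewrite eq_sym.
Qed.

Lemma Alt_sub_tperm a b : a != b -> tperm a b \in G -> 'Alt_T \subset G.
Proof.
move=> ab Gab; apply: Alt_sub_cyc3 => x y z xy xz _.
have Gt u v : u != v -> tperm u v \in G.
  by move=> uv; have [g Gg [<- <-]] := G2 ab uv; rewrite -tpermJ groupJ.
by rewrite groupM ?Gt.
Qed.

(** Take a moved point a. If [t] swaps a and [t a], another moved x would give four moved points a,
    [t a], x, [t x]. Otherwise a, [t a], [t (t a)] fill the support. *)
Lemma moved_le3 t : t != 1 -> (#|moved t| <= 3)%N ->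
  (exists a b, a != b /\ t = tperm a b) \/
  (exists a b c, [/\ a != b, a != c, b != c & t = cyc3 a b c]).
Proof.
move=> t1 m3; have [a ta] : exists a, t a != a.
  apply/existsP; rewrite -negb_forall; apply: contraNN t1 => /forallP t1.
  by apply/eqP/permP => x; rewrite perm1; apply/eqP.
have mE x : (x \in moved t) = (t x != x) by rewrite inE.
have ttx x : (t (t x) != t x) = (t x != x) by rewrite (inj_eq perm_inj).
have [t2|t2] := eqVneq (t (t a)) a.
  left; exists a, (t a); rewrite eq_sym; split=> //; apply/permP => x.
  case: tpermP => [-> //|-> //|xa xta]; apply/eqP/negPn/negP => tx.
  have sub : [:: a; t a; x; t x] \subset moved t.
    by apply/fintype.subsetP => y; rewrite !inE => /or4P[] /eqP->; rewrite ?ttx ?ta.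
  have: uniq [:: a; t a; x; t x].
    move/eqP: xa => xa; move/eqP: xta => xta.
    have atx : a != t x by rewrite -{1}t2 (inj_eq perm_inj) eq_sym.
    rewrite /= !inE !negb_or atx (inj_eq perm_inj) [a == x]eq_sym xa.
    by rewrite [t a == x]eq_sym xta [a == t a]eq_sym ta [x == t x]eq_sym tx.
  by move/card_uniqP=> uc; have:= leq_trans (subset_leq_card sub) m3; rewrite uc.
right; exists a, (t a), (t (t a)); split; rewrite 1?eq_sym ?ttx //.
have u3 : uniq [:: a; t a; t (t a)].
  by rewrite /= !inE negb_or [a == t a]eq_sym ta [a == _]eq_sym t2 [t a == _]eq_sym ttx ta.
have sub : [:: a; t a; t (t a)] \subset moved t.
  by apply/fintype.subsetP => y; rewrite !inE => /or3P[] /eqP->; rewrite ?ttx ta.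
have mvE : moved t =i [:: a; t a; t (t a)].
  have/subset_cardP : #|[:: a; t a; t (t a)]| = #|moved t|.
    apply/eqP; rewrite eqn_leq subset_leq_card // (card_uniqP u3).
    exact: m3.
  by move=> E x; have /E -> := sub.
have t3 : t (t (t a)) = a.
  have: t (t (t a)) \in moved t by rewrite mE !ttx.
  rewrite mvE !inE [_ == t a](inj_eq perm_inj) (negPf t2) /=.
  by rewrite !(inj_eq perm_inj) (negPf ta) orbF => /eqP.
case/and4P: u3; rewrite !inE negb_or => /andP[ata atta] tatta _ _.
apply/permP => x; have [xm|] := boolP (x \in moved t).
  move: xm; rewrite mvE !inE => /or3P[] /eqP->.
  - by rewrite cyc3E1.
  - by rewrite cyc3E2.
  - by rewrite cyc3E3 // t3.
move=> xm; have := xm; rewrite mvE !inE !negb_or => /and3P[xa xb xc].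
rewrite cyc3D 1?eq_sym //; move: xm; rewrite mE negbK; exact/eqP.
Qed.

Lemma Alt_sub_moved_le3 t :
  t \in G -> t != 1 -> (#|moved t| <= 3)%N -> 'Alt_T \subset G.
Proof.
move=> Gt t1 /(moved_le3 t1)[[a [b [ab tE]]]|[a [b [c [ab ac bc tE]]]]].
  by apply: (Alt_sub_tperm ab); rewrite -tE.
by apply: (Alt_sub_one_cyc3 ab ac bc); rewrite -tE.
Qed.

Lemma Alt_sub_eq : 'Alt_T \subset G -> G = 'Alt_T :> {set _} \/ G = 'Sym_T :> {set _}.
Proof.
move=> sAG; have [sGA|/subsetPn[h Gh]] := boolP (G \subset 'Alt_T).
  by left; apply/eqP; rewrite finset.eqEsubset sGA.
rewrite Alt_even negbK => odd_h; right; apply/setP => s; rewrite [RHS]inE.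
have [even_s|odd_s] := boolP (s \in 'Alt_T); first exact: (fintype.subsetP sAG).
rewrite Alt_even negbK in odd_s.
rewrite -[s](mulgK h) groupMr ?groupV // (fintype.subsetP sAG) // Alt_even.
by rewrite odd_permM odd_s odd_h.
Qed.

End AlternatingGroup.

(** * Minimal degree of 2-transitive groups *)

Section PairCounting.

Local Open Scope nat_scope.

Variables (T : finType) (G : {group {perm T}}).
Hypothesis G2 : double_transitive G.

Definition act2 (g : {perm T}) (u : T * T) : T * T := (g u.1, g u.2).

Definition offdiag : {set T * T} := [set u | u.1 != u.2]%SET.

(** The number [K v] of elements sending [u] to [v] is the same for all off-diagonal [v], by
    translation in [G]. Hence a proportion #|Q| / #|offdiag| of [G] sends [u] into [Q]. *)
Lemma sum_act2_point (Q : {set T * T}) u : u \in offdiag -> Q \subset offdiag ->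
  ((\sum_(g in G) (act2 g u \in Q)) * #|offdiag| = #|Q| * #|G|)%N.
Proof.
move=> ou; pose K v := \sum_(g in G) (act2 g u == v) : nat.
have KE v : v \in offdiag -> K v = K u.
  rewrite !inE in ou * => ov; have [h Gh [h1 h2]] := G2 ov ou.
  rewrite /K (reindex_inj (mulIg h^-1%g)).
  apply: eq_big => [g|g _]; first by rewrite groupMr ?groupV.
  have hV x y : h x = y -> forall z, ((g * h^-1)%g z == x) = (g z == y).
    by move=> <- z; rewrite permM (can2_eq (permKV _) (permK _)).
  by rewrite [u in RHS]surjective_pairing [v]surjective_pairing !xpair_eqE
    (hV _ _ h1) (hV _ _ h2).
have KQ (A : {set T * T}) : A \subset offdiag ->
    (\sum_(g in G) (act2 g u \in A) = #|A| * K u)%N.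
  move=> sA; rewrite -sum_nat_const -(eq_bigr _ (fun v Av => KE v (fintype.subsetP sA v Av))).
  rewrite exchange_big; apply: eq_bigr => g _.
  have [gA|gA] := boolP (_ \in A).
    by rewrite (bigD1 _ gA) /= eqxx big1 // => v /andP[_]; rewrite eq_sym => /negPf->.
  by rewrite big1 // => v vA; case: eqP => // gv; rewrite gv vA in gA.
move=> sQ; rewrite KQ // -mulnA; congr muln.
rewrite mulnC -KQ // -sum1_card; apply: eq_bigr => g _.
by move: ou; rewrite !inE (inj_eq perm_inj) => ->.
Qed.

Lemma sum_act2 (P Q : {set T * T}) : P \subset offdiag -> Q \subset offdiag ->
  ((\sum_(g in G) #|[set u in P | act2 g u \in Q]%SET|) * #|offdiag| =
    #|P| * (#|Q| * #|G|))%N.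
Proof.
move=> sP sQ; rewrite -sum_nat_const.
rewrite -(eq_bigr _ (fun u Pu => sum_act2_point (fintype.subsetP sP u Pu) sQ)).
rewrite -big_distrl /= exchange_big; congr muln; apply: eq_bigr => g _.
rewrite -sum1_card big_mkcond [RHS]big_mkcond /=; apply: eq_bigr => u _.
by rewrite inE; case: (u \in P); case: (_ \in Q).
Qed.

Lemma card_offdiag_fst (A : {set T}) :
  #|[set u : T * T | (u.1 \in A) && (u.1 != u.2)]%SET| = (#|A| * #|T|.-1)%N.
Proof.
rewrite -sum1_card (eq_bigl (fun u => (u.1 \in A) && (u.1 != u.2))); last first.
  by move=> u; rewrite inE.
rewrite -(pair_big_dep (mem A) (fun a b => a != b) (fun _ _ => 1%N)) /=.
rewrite -sum_nat_const; apply: eq_bigr => a _.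
by rewrite sum1_card (eq_card (B := predC1 a)) ?cardC1 // => b; rewrite !inE eq_sym.
Qed.

Lemma card_offdiag_sq (A : {set T}) :
  #|[set u : T * T | [&& u.1 \in A, u.2 \in A & u.1 != u.2]]%SET| = (#|A| * #|A|.-1)%N.
Proof.
rewrite -sum1_card.
rewrite (eq_bigl (fun u => (u.1 \in A) && ((u.2 \in A) && (u.1 != u.2)))); last first.
  by move=> u; rewrite inE.
rewrite -(pair_big_dep (mem A) (fun a b => (b \in A) && (a != b)) (fun _ _ => 1%N)) /=.
rewrite -sum_nat_const; apply: eq_bigr => a aA.
rewrite sum1_card (cardsD1 a A) aA /=; apply: eq_card => b.
by rewrite !inE [b \in (fun _ => _)]unfold_in eq_sym andbC.
Qed.

Lemma card_offdiag : #|offdiag| = (#|T| * #|T|.-1)%N.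
Proof.
have := card_offdiag_fst [set: T]; rewrite cardsT => <-.
by apply: eq_card => u; rewrite !inE.
Qed.

End PairCounting.

(** * Commutators and overlapping supports *)

Section Commutators.

Local Open Scope nat_scope.

Variable T : finType.
Implicit Types t u : {perm T}.

(** As [t * u] is [u * t] followed by the commutator, a moved point is the image under [u * t] of
    some x at which the two products differ. Then x, [u x] or [t x] lies in both supports: three
    sets of equal size. *)
Lemma card_moved_commutator t u :
  (#|moved [~ t, u]%g| <= 3 * #|moved t :&: moved u|)%N.
Proof.
set I := moved t :&: moved u.
have sub : moved [~ t, u]%g \subset
    (u * t)%g @: (I :|: (u @^-1: I :|: t @^-1: I)).
  apply/fintype.subsetP => y; rewrite inE => cy.
  have -> : y = (u * t)%g ((u * t)^-1%g y) by rewrite permKV.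
  move: cy; set x := ((u * t)^-1)%g y; have -> : y = (u * t)%g x by rewrite permKV.
  rewrite -permM -commgC => tux.
  apply: imset_f; rewrite !inE.
  move: tux; have [tx|tx] := eqVneq (t x) x; have [ux|ux] := eqVneq (u x) x => //=.
  - by rewrite !permM tx ux tx eqxx.
  - by rewrite !permM tx (inj_eq perm_inj) ux eq_sym => ->.
  - by rewrite !permM ux (inj_eq perm_inj) tx => ->; rewrite orbT.
apply: leq_trans (subset_leq_card sub) _; rewrite card_imset; last exact: perm_inj.
apply: leq_trans (leq_card_setU _ _) _; rewrite mulSn leq_add2l.
apply: leq_trans (leq_card_setU _ _) _.
by rewrite !card_preimset ?mul2n ?addnn //; apply: perm_inj.
Qed.

Lemma moved_commute t u a : commute t u -> (t^-1%g a \in moved u) = (a \in moved u).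
Proof.
move=> tu; rewrite !inE -permM -(commuteV (commute_sym tu)) permM.
by rewrite (inj_eq perm_inj).
Qed.

Lemma movedJ t g a : (a \in moved (t ^ g^-1)%g) = (g a \in moved t).
Proof.
rewrite !inE conjgE invgK !permM (can2_eq (permKV _) (permK _)) //.
Qed.

End Commutators.

(** * Averaging the overlap of the support with its translates *)

Section MinimalDegree.

Local Open Scope nat_scope.

Variables (T : finType) (G : {group {perm T}}) (t : {perm T}).
Hypothesis G2 : double_transitive G.
Hypothesis Gt : t \in G.

Let S := moved t.
Let m := #|S|.
Let n := #|T|.

Hypothesis m_min : forall u, u \in G -> u != 1%g -> m <= #|moved u|.
Hypothesis m_gt3 : 3 < m.

(* [I g] is the intersection of the supports of [t] and of its conjugate by
   [g^-1], and [E g] the part of it that [t^-1] moves out of the second support: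
   if [E g] is nonempty, then the two conjugates do not commute. *)
Let I (g : {perm T}) : {set T} := [set a in S | g a \in S]%SET.
Let E (g : {perm T}) : {set T} :=
  [set a in S | (g a \in S) && (g (t^-1%g a) \notin S)]%SET.

Lemma overlap_large g : g \in G -> 0 < #|E g| -> m <= 3 * #|I g|.
Proof.
move=> Gg /card_gt0P[a]; rewrite !inE => /and3P[ta tga tgta].
set u := (t ^ g^-1)%g; have Gu : u \in G by rewrite groupJ ?groupV.
have -> : I g = moved t :&: moved u.
  by apply/setP => x; rewrite finset.in_setI movedJ !inE.
apply: leq_trans (card_moved_commutator t u); apply: m_min.
  by rewrite groupR.
apply: contraNN tgta => /commgP/(moved_commute a).
by rewrite !movedJ !inE => ->.
Qed.

Lemma card_E_le g : #|E g| <= #|I g|.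
Proof.
by apply/subset_leq_card/fintype.subsetP => x; rewrite !inE => /and3P[-> ->].
Qed.

(** The inequality says that #|I g| is not 1. If [E g] is nonempty, 3 < m <= 3 #|I g|. If it is
    empty, [t^-1] maps [I g] to itself without fixed points. *)
Lemma overlap_neq1 g : g \in G -> #|I g| <= #|I g| * #|I g|.-1.
Proof.
move=> Gg; have [E0|] := posnP #|E g|; last first.
  by move/(overlap_large Gg); move: m_gt3; case: #|I g| => [|[|k]] //; nia.
have [->//|/card_gt0P[a aI]] := posnP #|I g|.
suff : 1 < #|I g| by case: #|I g| => [|[|k]] //; nia.
have /andP[aS gaS] : (a \in S) && (g a \in S) by move: aI; rewrite inE.
have tIn : t^-1%g a \in I g.
  rewrite inE moved_commute // aS /=; apply: contraT => ngS.
  have: a \in E g by rewrite inE aS gaS ngS.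
  by rewrite (cards0_eq E0) inE.
apply/card_gt1P; exists a, (t^-1%g a); split=> //.
by move: aS; rewrite inE; apply: contraNneq => {1}->; rewrite permKV.
Qed.

(** With i = #|I g| and e = #|E g| this reads (m - 6) e <= 3 i (i - 2). For e > 0 it follows from m
    <= 3 i, e <= i and i >= 2; for e = 0, from i != 1. It is linear in quantities whose averages
    over [G] are computable. *)
Lemma overlap_ineq g : g \in G ->
  3 * #|I g| + m * #|E g| <= 3 * (#|I g| * #|I g|.-1) + 6 * #|E g|.
Proof.
move=> Gg; have := overlap_neq1 Gg; have := overlap_large Gg; have := card_E_le g.
move: m_gt3; case: #|E g| => [|k]; first by rewrite !muln0; lia.
case: #|I g| => [|[|[|x]]] /=; [by []| | |] => m3 kx /(_ isT) m3x; nia.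
Qed.

(** Each point of [I g] is completed by an arbitrary second point, so that the count of pairs
    applies; the factor [n.-1] then cancels. *)
Lemma sum_I : (\sum_(g in G) #|I g|) * (n * n.-1) = m * m * n.-1 * #|G|.
Proof.
have n1 : 0 < n.-1.
  by rewrite -ltnS prednK; have := max_card (mem S); rewrite -/n -/m; lia.
pose P : {set T * T} := [set u | (u.1 \in S) && (u.1 != u.2)]%SET.
have sP : P \subset offdiag T.
  by apply/fintype.subsetP => u; rewrite !inE => /andP[].
have := sum_act2 G2 sP sP; rewrite card_offdiag card_offdiag_fst -/n -/m.
rewrite (eq_bigr (fun g => #|I g| * n.-1)) => [|g _]; last first.
  rewrite -card_offdiag_fst; apply: eq_card => u.
  by rewrite !inE (inj_eq perm_inj); do !case: (_ != _).
rewrite -big_distrl /= => H; apply/eqP; rewrite -(eqn_pmul2r n1).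
by apply/eqP; move: H; move: (\sum_(g in G) #|I g|) (n.-1) => A k; clear; nia.
Qed.

Lemma sum_II :
  (\sum_(g in G) #|I g| * #|I g|.-1) * (n * n.-1) = m * m * m.-1 ^ 2 * #|G|.
Proof.
pose P : {set T * T} := [set u | [&& u.1 \in S, u.2 \in S & u.1 != u.2]]%SET.
have sP : P \subset offdiag T.
  by apply/fintype.subsetP => u; rewrite !inE => /and3P[].
have := sum_act2 G2 sP sP; rewrite card_offdiag card_offdiag_sq -/n -/m => H.
rewrite (eq_bigr (fun g => #|[set u in P | act2 g u \in P]%SET|)) => [|g _].
  by rewrite H; clear; nia.
rewrite -card_offdiag_sq; apply: eq_card => u.
by rewrite !inE (inj_eq perm_inj); do !case: (_ != _).
Qed.

(** The points of [E g] are the pairs (a, [t^-1 a]) with a in [S] that [g] sends into the product of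
    [S] and its complement. *)
Lemma sum_E : (\sum_(g in G) #|E g|) * (n * n.-1) = m * m * (n - m) * #|G|.
Proof.
pose f a := (a, t^-1%g a).
have f_inj : injective f by move=> a b [].
pose P : {set T * T} := f @: S; pose Q : {set T * T} := finset.setX S (~: S).
have sP : P \subset offdiag T.
  apply/fintype.subsetP => u /imsetP[a]; rewrite !inE => ta ->.
  by apply: contraNneq ta => /= {1}->; rewrite permKV.
have sQ : Q \subset offdiag T.
  apply/fintype.subsetP => u; rewrite !inE => /andP[t1]; rewrite negbK => t2.
  by apply: contraNneq t1 => ->.
have := sum_act2 G2 sP sQ; rewrite card_offdiag card_imset // cardsX -/n -/m.
rewrite [#|~: S|]cardsCs finset.setCK -/n -/m => H.
rewrite (eq_bigr (fun g => #|[set u in P | act2 g u \in Q]%SET|)) => [|g _].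
  by rewrite H; clear; nia.
rewrite -(card_imset _ f_inj); apply: eq_card => u.
rewrite [in RHS]inE; apply/imsetP/andP => [[a aE ->]|[/imsetP[a aS ->] aQ]].
  move: aE; rewrite !inE => /and3P[ta tga gta]; split; last by rewrite tga.
  by apply: imset_f; rewrite inE.
by exists a => //; move: aS aQ; rewrite !inE => -> /=.
Qed.

(** These are [overlap_neq1] and [overlap_ineq] averaged over [G], multiplied by n (n - 1) / m^2. *)
Lemma minimal_degree_bound :
  n.-1 <= m.-1 ^ 2 /\ 3 * n.-1 + m * (n - m) <= 3 * m.-1 ^ 2 + 6 * (n - m).
Proof.
have sI := sum_I; have sII := sum_II; have sE := sum_E.
have N0 : 0 < m * m * #|G| by rewrite !muln_gt0 cardG_gt0 andbT; lia.
have le1 : \sum_(g in G) #|I g| <= \sum_(g in G) #|I g| * #|I g|.-1.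
  by apply: leq_sum => g; apply: overlap_neq1.
have le2 : 3 * (\sum_(g in G) #|I g|) + m * (\sum_(g in G) #|E g|) <=
    3 * (\sum_(g in G) #|I g| * #|I g|.-1) + 6 * (\sum_(g in G) #|E g|).
  rewrite [3 * _]big_distrr [m * _]big_distrr [X in _ <= X + _]big_distrr.
  rewrite [6 * _]big_distrr -!big_split /=.
  by apply: leq_sum => g; apply: overlap_ineq.
have D1 := leq_mul le1 (leqnn (n * n.-1)).
have D2 := leq_mul le2 (leqnn (n * n.-1)).
have e x : m * m * x * #|G| = m * m * #|G| * x by rewrite mulnAC.
rewrite sI sII !e leq_pmul2l // in D1; split=> //.
rewrite (mulnDl (3 * _)) (mulnDl (3 * _)) -!(mulnA _ _ (n * n.-1)) sI sII sE !e in D2.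
move: N0 D2; move: (m * m * #|G|) => q q0 D2.
by rewrite !(mulnCA _ q) -!mulnDr leq_pmul2l // in D2.
Qed.

End MinimalDegree.

(** * Transitive groups of prime degree *)

Section DifferenceOperator.

Variable p : nat.
Hypothesis p_pr : prime p.

Local Notation F := 'F_p.
Implicit Types (D : {set F}) (h : {poly F}).

Definition power_sum D (j : nat) : F := \sum_(d in D) d ^+ j.

(** The Taylor expansion, with Hasse derivatives, of the sum over d in [D] of h(x + d) - h(x). The
    polynomial form makes degrees comparable. *)
Definition diffop D h : {poly F} := \sum_(1 <= j < size h) power_sum D j *: h^`N(j).

Lemma size_sum_leq (I : Type) (r : seq I) (P : pred I) (f : I -> {poly F}) n :
  (forall i, P i -> size (f i) <= n)%N -> (size (\sum_(i <- r | P i) f i)%R <= n)%N.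
Proof.
move=> fn; apply: (big_ind (fun q : {poly F} => size q <= n)%N) => //.
  by rewrite size_poly0.
by move=> q1 q2 q1n q2n; apply: leq_trans (size_polyD _ _) _; rewrite geq_max q1n.
Qed.

Lemma diffop_horner D h x :
  (diffop D h).[x] = \sum_(d in D) (h.[x + d] - h.[x]).
Proof.
have [->|h0] := eqVneq h 0.
  rewrite /diffop size_poly0 big_geq // horner0 big1 // => d _.
  by rewrite !horner0 subr0.
have E d : h.[x + d] - h.[x] = \sum_(1 <= j < size h) h^`N(j).[x] * d ^+ j.
  rewrite nderiv_taylor; last exact: mulrC.
  rewrite -(big_mkord xpredT (fun i => h^`N(i).[x] * d ^+ i)) big_ltn ?size_poly_gt0 //.
  by rewrite nderivn0 expr0 mulr1 addrAC subrr add0r.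
rewrite (eq_bigr _ (fun d _ => E d)) exchange_big /= /diffop horner_sum.
apply: eq_bigr => j _; rewrite hornerZ /power_sum big_distrl /=.
by apply: eq_bigr => d _; rewrite mulrC.
Qed.

Lemma size_diffop D h : (size (diffop D h) <= size h)%N.
Proof.
apply: size_sum_leq => j _; apply: leq_trans (size_scale_leq _ _) _.
apply/leq_sizeP => i hi; rewrite coef_nderivn nth_default ?mul0rn //.
exact: leq_trans (leq_addl _ _).
Qed.

Lemma diffop_small D h k : (forall j, (0 < j < k)%N -> power_sum D j = 0) ->
  (size h <= k)%N -> diffop D h = 0.
Proof.
move=> s0 hk; rewrite /diffop big_nat big1 // => j /andP[j0 jh].
by rewrite s0 ?scale0r // j0 (leq_trans jh).
Qed.

(** The binomial divides m!, all of whose factors are below [p]. *)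
Lemma bin_Fp_neq0 m k : (k <= m < p)%N -> 'C(m, k)%:R != 0 :> F.
Proof.
case/andP=> km mp; rewrite -(dvdn_pcharf (pchar_Fp p_pr)).
have: ~~ (p %| m`!)%N.
  rewrite fact_prod Euclid_dvd_prod // big_has; apply/hasPn => i.
  rewrite mem_index_iota => /andP[i0 im]; apply/negP => /(dvdn_leq i0).
  by rewrite leqNgt (leq_ltn_trans _ mp).
by rewrite -(bin_fact km); apply: contraNN => /dvdn_mulr; apply.
Qed.

(** Terms with j < k vanish and those with j > k have too low a degree, so the coefficient is the
    power sum times the leading coefficient times a binomial. *)
Lemma coef_diffop_neq0 D h k : (forall j, (0 < j < k)%N -> power_sum D j = 0) ->
    power_sum D k != 0 -> (0 < k < size h)%N -> (size h <= p)%N ->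
  (diffop D h)`_((size h).-1 - k) != 0.
Proof.
move=> s0 sk /andP[k0 kh] hp.
have hgt0 : (0 < size h)%N by apply: leq_trans kh.
rewrite /diffop coef_sum (bigD1_seq k) ?mem_index_iota ?iota_uniq ?k0 //=.
rewrite big_seq_cond big1 => [|j]; last rewrite mem_index_iota => /andP[/andP[j0 jh] jk].
  rewrite addr0 coefZ coef_nderivn subnKC; last by rewrite -ltnS prednK.
  rewrite -mulr_natr !mulf_neq0 //; first by rewrite -lead_coefE lead_coef_eq0 -size_poly_gt0.
  by apply: bin_Fp_neq0; rewrite -ltnS prednK ?kh.
case: (ltngtP j k) jk => // jk _; first by rewrite s0 ?j0 // scale0r coef0.
have aux (a b c : nat) : (b < a -> b < c -> a <= c + (a.-1 - b))%N by lia.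
by rewrite coefZ coef_nderivn nth_default ?mul0rn ?mulr0 // aux.
Qed.

Lemma poly_eq0_Fp h : (size h <= p)%N -> (forall x, h.[x] = 0) -> h = 0.
Proof.
move=> hp h0; apply: (@roots_geq_poly_eq0 _ h (enum F)); first 1 last.
- exact: enum_uniq.
- by rewrite -cardE card_Fp.
by apply/allP => x _; rewrite rootE h0.
Qed.

(** By Fermat's little theorem, 1 - (X - a)^(p-1) is the indicator function of a. *)
Lemma interpolation_Fp (f : F -> F) : exists2 h : {poly F}, (size h <= p)%N & forall x, h.[x] = f x.
Proof.
exists (\sum_a f a *: (1 - ('X - a%:P) ^+ p.-1)).
  apply: size_sum_leq => a _; apply: leq_trans (size_scale_leq _ _) _.
  apply: leq_trans (size_polyD _ _) _; rewrite size_polyN size_poly1 size_exp_XsubC.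
  by rewrite prednK ?prime_gt0 // geq_max leqnn prime_gt0.
move=> x; rewrite horner_sum (bigD1 x) //= big1 => [|a ax].
  rewrite hornerZ hornerD hornerN horner_exp hornerXsubC subrr hornerC.
  by rewrite expr0n -subn1 subn_eq0 leqNgt prime_gt1 //= subr0 mulr1 addr0.
rewrite hornerZ hornerD hornerN horner_exp hornerXsubC hornerC.
have xa : x - a != 0 by rewrite subr_eq0 eq_sym.
suff -> : (x - a) ^+ p.-1 = 1 by rewrite subrr mulr0.
apply: (mulfI xa); rewrite -exprS prednK ?prime_gt0 // mulr1.
by have := expf_card (x - a); rewrite card_Fp.
Qed.

(** The polynomial [w] has degree #|D| and vanishes at 0 and on [D] except at [d0]. Its sum over [D]
    is thus nonzero, yet it is a combination of the power sums of orders 1 to #|D|. *)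
Lemma power_sum_neq0 D : D != finset.set0 -> 0 \notin D ->
  exists2 k, (0 < k <= #|D|)%N & power_sum D k != 0.
Proof.
case/finset.set0Pn => d0 Dd0 D0.
pose w : {poly F} := 'X * \prod_(d <- enum (D :\ d0)) ('X - d%:P).
have sw : size w = #|D|.+1.
  rewrite /w mulrC size_mulX ?size_prod_XsubC; last first.
    by rewrite -size_poly_gt0 size_prod_XsubC.
  by rewrite -cardE (cardsD1 d0 D) Dd0.
have wd d : d \in D -> d != d0 -> w.[d] = 0.
  move=> dD dd0; rewrite hornerM horner_prod (bigD1_seq d) ?enum_uniq //=.
    by rewrite hornerXsubC subrr mul0r mulr0.
  by rewrite mem_enum !inE dd0.
have wd0 : w.[d0] != 0.
  rewrite hornerM hornerX mulf_neq0 //; first by apply: contraNneq D0 => <-.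
  rewrite horner_prod prodf_seq_neq0; apply/allP => d.
  rewrite mem_enum !inE => /andP[dd0 _] /=.
  by rewrite hornerXsubC subr_eq0 eq_sym.
have [/existsP[k /andP[k0 sk]]|] :=
    boolP [exists k : 'I_#|D|.+1, (0 < k)%N && (power_sum D k != 0)].
  by exists k; rewrite // k0 -ltnS ltn_ord.
rewrite negb_exists => /forallP s0; case/negP: wd0; apply/eqP.
have -> : w.[d0] = \sum_(d in D) w.[d].
  by rewrite (bigD1 d0) //= big1 ?addr0 // => d /andP[]; apply: wd.
rewrite (eq_bigr (fun d => \sum_(i < size w) w`_i * d ^+ i)) => [|d _]; last first.
  exact: horner_coef.
rewrite exchange_big big1 // => i _ /=; rewrite -big_distrr /= -/(power_sum D i).
have [i0|i0] := posnP i; first by rewrite i0 coefXM mul0r.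
have iD : (i < #|D|.+1)%N by rewrite -sw.
by have := s0 (Ordinal iD); rewrite /= i0 negbK => /eqP->; rewrite mulr0.
Qed.

(** For fixed x, the injective map d -> f(x + d) - f(x) permutes [D], which allows reindexing the
    sum. *)
Lemma diffop_comp D (f : F -> F) (q h : {poly F}) :
    injective f -> (forall x d, d \in D -> f (x + d) - f x \in D) ->
    (forall x, q.[x] = h.[f x]) ->
  forall x, (diffop D q).[x] = (diffop D h).[f x].
Proof.
move=> f_inj fD qh x; rewrite !diffop_horner.
pose g d := f (x + d) - f x.
have g_inj : injective g by move=> d1 d2 /addIr /f_inj /addrI.
have gD : g @: D = D.
  apply/eqP; rewrite eqEcard card_imset // leqnn andbT.
  by apply/fintype.subsetP => _ /imsetP[d dD ->]; apply: fD.
rewrite -[in RHS]gD big_imset /=; last by move=> d1 d2 _ _; apply: g_inj.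
by apply: eq_bigr => d _; rewrite !qh /g [f x + _]addrC subrK.
Qed.

(* [diffop D] lowers the degree of a polynomial by exactly [k], where [k] is
   least with [power_sum D k != 0], and it commutes with substituting [f]. If
   [k = 1], the image of the interpolant [q] of [f] is constant, so [q] has
   degree at most 1. If [k > 1], then [diffop D q = 0], so [q] has degree less
   than [k]; were this degree at least 2, some power [q ^+ l] with [l < k] would
   have degree in [k, 2k), although [diffop D] kills it as it kills ['X^l]. *)
Lemma affine_of_difference_set D (f : F -> F) :
    D != finset.set0 -> 0 \notin D -> (2 * #|D| < p)%N ->
    injective f -> (forall x d, d \in D -> f (x + d) - f x \in D) ->
  exists a b, forall x, f x = a * x + b.
Proof.
move=> Dn0 D0 Dp f_inj fD.
have exk : exists k, (0 < k)%N && (power_sum D k != 0).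
  by have [k /andP[k0 _] sk] := power_sum_neq0 Dn0 D0; exists k; rewrite k0.
case: (ex_minnP exk) => k /andP[k0 sk] kmin.
have kp : (2 * k < p)%N.
  have [j /andP[j0 jD] sj] := power_sum_neq0 Dn0 D0.
  by have := kmin j; rewrite j0 sj => /(_ isT); lia.
have s0 j : (0 < j < k)%N -> power_sum D j = 0.
  case/andP=> j0 jk; apply/eqP; apply: contraTT jk => sj.
  by rewrite -leqNgt kmin // j0.
have [q qp qf] := interpolation_Fp f.
have qcomp n x : (diffop D (q ^+ n)).[x] = (diffop D 'X^n).[f x].
  by apply: diffop_comp => // y; rewrite !horner_exp hornerX qf.
suff q2 : (size q <= 2)%N.
  exists q`_1, q`_0 => x; rewrite -qf (horner_coef_wide _ q2).
  by rewrite big_ord_recl big_ord1 /= expr0 mulr1 addrC.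
have vanish n : (k < size (q ^+ n) <= p)%N -> diffop D 'X^n = 0 -> False.
  case/andP=> kq qnp Dn; suff Dq : diffop D (q ^+ n) = 0.
    by have := coef_diffop_neq0 s0 sk; move/(_ (q ^+ n)); rewrite Dq coef0 eqxx k0 kq => /(_ isT qnp).
  apply: poly_eq0_Fp; first exact: leq_trans (size_diffop _ _) qnp.
  by move=> x; rewrite qcomp Dn horner0.
rewrite leqNgt; apply/negP => q3.
have [k1|k_neq1] := eqVneq k 1.
  pose r := diffop D q - (power_sum D 1)%:P.
  have r0 : r = 0.
    apply: poly_eq0_Fp.
      apply: leq_trans (size_polyD _ _) _; rewrite geq_max size_polyN.
      rewrite (leq_trans (size_diffop _ _)) // (leq_trans (size_polyC_leq1 _)) //.
      exact: prime_gt0.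
    move=> x; rewrite hornerD hornerN hornerC -[q]expr1 qcomp.
    rewrite diffop_horner (eq_bigr id) => [|d _]; last by rewrite !hornerXn; ring.
    by rewrite /power_sum (eq_bigr id) ?subrr // => d _; rewrite expr1.
  have := coef_diffop_neq0 s0 sk; move/(_ q); rewrite k1 (ltn_trans _ q3) //.
  move=> /(_ isT qp) /negP; apply; apply/eqP.
  move/eqP: r0; rewrite subr_eq0 => /eqP ->; rewrite coefC.
  by case: (size q) q3 => [|[|[|n]]].
have k2 : (1 < k)%N by rewrite ltn_neqAle eq_sym k_neq1.
have qk : (size q <= k)%N.
  rewrite leqNgt; apply/negP => kq; apply: (@vanish 1%N); rewrite ?expr1 ?kq //.
  by apply: diffop_small s0 _; rewrite size_polyX.
set n := (size q).-1; have n2 : (1 < n)%N by rewrite /n; lia.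
have nk : (n < k)%N by rewrite /n; lia.
(* This is k / n rounded up, so k <= l n <= k + n - 1 < 2k; moreover l < k since n >= 2. *)
pose l := ((k + n.-1) %/ n)%N.
have l1 : (k <= l * n)%N.
  have := ltn_ceil (k + n.-1) (ltnW n2); rewrite -/l; nia.
have l2 : (l * n <= k + n.-1)%N := leq_trunc_div _ _.
have lk : (l < k)%N by nia.
have sql : size (q ^+ l) = (l * n).+1.
  rewrite -[LHS]prednK ?size_exp -/n 1?mulnC //.
  by rewrite size_poly_gt0 expf_neq0 // -size_poly_gt0 (ltn_trans _ q3).
apply: (@vanish l).
  by rewrite sql; apply/andP; split; lia.
by apply: diffop_small s0 _; rewrite size_polyXn.
Qed.

End DifferenceOperator.

(** * Burnside's theorem on groups of prime degree *)

Section Burnside.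

Variables (T : finType) (p : nat) (G : {group {perm T}}).
Hypotheses (p_pr : prime p) (cardT : #|T| = p).
Hypothesis G_trans : forall x y, exists2 g, g \in G & g x = y.

(** By Cauchy's theorem [G] has an element [c] of order p. Labelling [c ^+ x] applied to a moved
    point [x0] by x turns [c] into translation by 1. *)
Lemma cyclic_labelling : exists c (e : 'F_p -> T),
  [/\ c \in G, bijective e & forall x y, e (x + y) = (c ^+ y)%g (e x)].
Proof.
have /card_gt0P[a _] : (0 < #|T|)%N by rewrite cardT prime_gt0.
have orbT : orbit 'P G a = [set: T].
  apply/setP => y; rewrite inE; have [g Gg <-] := G_trans a y.
  by apply/orbitP; exists g.
have pG : (p %| #|G|)%N by rewrite -cardT -cardsT -orbT dvdn_orbit.
have [c Gc oc] := Cauchy p_pr pG.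
have [x0 cx0] : exists x0, c x0 != x0.
  apply/existsP; rewrite -negb_forall; apply/negP => /forallP c1.
  suff c_eq1 : c = 1%g by have := prime_gt1 p_pr; rewrite -oc c_eq1 order1.
  by apply/permP => x; rewrite perm1; apply/eqP.
pose e (x : 'F_p) := (c ^+ x)%g x0.
have eD x y : e (x + y) = (c ^+ y)%g (e x).
  have xyE : nat_of_ord (x + y) = ((x + y) %% p)%N.
    by congr (_ %% _)%N; exact: Fp_cast.
  by rewrite /e xyE expg_mod ?expgD ?permM // -[in LHS]oc expg_order.
have e_inj : injective e.
  move=> x y exy; apply/eqP; rewrite -subr_eq0; apply: contraNT cx0 => z0.
  have step n : e (y + (x - y) *+ n) = e y.
    elim: n => [|n IHn]; first by rewrite mulr0n addr0.
    by rewrite mulrSr addrA eD IHn -eD addrC subrK.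
  (* If two labels x != y gave the same point, adding x - y repeatedly would reach y + 1, so [c]
     would fix [x0]. *)
  have := step (nat_of_ord (x - y)^-1).
  have -> : (x - y) *+ (nat_of_ord (x - y)^-1) = 1.
    by rewrite -mulr_natr natr_Zp divff.
  rewrite eD /e -[LHS]permM -expgD addnC expgD permM => /perm_inj.
  by have -> : nat_of_ord (1 : 'F_p) = 1%N by []; rewrite expg1 => ->.
exists c, e; split=> //; apply: inj_card_bij => //.
by rewrite cardT card_Fp.
Qed.

Lemma transitive_prime_degree : double_transitive G \/
  (forall g, g \in G -> g != 1%g -> (p <= #|moved g|.+1)%N).
Proof.
have [c [e [Gc [e' eK e'K] eD]]] := cyclic_labelling.
have [|nG2] := EM (double_transitive G); [by left|right].
have [a [b [a' [b' [ab a'b' nG]]]]] : exists a b a' b', [/\ a != b, a' != b' &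
    forall g, g \in G -> g a = a' -> g b <> b'].
  apply: contrapT => H; apply: nG2 => a b a' b' ab a'b'.
  apply: contrapT => H'; apply: H; exists a, b, a', b'; split=> // g Gg ga gb.
  by apply: H'; exists g.
(* [D] collects the label differences of the images of (a, b) under [G]. Since translations lie in
   [G], it misses the difference of (a', b'). *)
pose D : {set 'F_p} := [set z | [exists g in G, exists x, (g a == e x) && (g b == e (x + z))]]%SET.
have DP z : reflect (exists g x, [/\ g \in G, g a = e x & g b = e (x + z)]) (z \in D).
  rewrite inE; apply: (iffP exists_inP).
    by case=> g Gg /existsP[x /andP[/eqP ga /eqP gb]]; exists g, x.
  by case=> g [x [Gg ga gb]]; exists g => //; apply/existsP; exists x; rewrite ga gb !eqxx.
pose f (g : {perm T}) x := e' (g (e x)).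
have f_inj g : injective (f g).
  by move=> x y /(can_inj e'K) /perm_inj /(can_inj eK).
have fK g x : f g^-1%g (f g x) = x by rewrite /f e'K permK eK.
have fD g x d : g \in G -> d \in D -> f g (x + d) - f g x \in D.
  (* The power of [c] moves the pair labelled y, y + d to x, x + d, to which [g] is then applied. *)
  move=> Gg /DP[h [y [Gh ha hb]]]; apply/DP; exists (h * c ^+ (x - y)%R * g)%g, (f g x).
  split; first by rewrite !groupM ?groupX.
    by rewrite !permM ha -eD /f e'K [y + _]addrC subrK.
  rewrite !permM hb -eD [f g x + _]addrC subrK /f e'K; congr (g (e _)).
  by rewrite addrAC [y + _]addrC subrK.
have D0 : 0 \notin D.
  apply/DP => -[g [x [_ ga gb]]]; move: ab; rewrite -(inj_eq (@perm_inj _ g)).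
  by rewrite ga gb addr0 eqxx.
have Dn0 : D != finset.set0.
  apply/finset.set0Pn; exists (e' b - e' a); apply/DP; exists 1%g, (e' a).
  by rewrite group1 !perm1 e'K addrC subrK e'K.
have ND : e' b' - e' a' \notin D.
  apply/DP => -[g [x [Gg ga gb]]].
  apply: (nG (g * c ^+ (e' a' - x)%R)%g); first by rewrite groupM ?groupX.
    by rewrite permM ga -eD [x + _]addrC subrK e'K.
  rewrite permM gb -eD; have -> : x + (e' b' - e' a') + (e' a' - x) = e' b' by ring.
  by rewrite e'K.
(* The nonzero differences outside [D] are preserved as well, because [g^-1] preserves [D]. The
   smaller of [D] and [D'] has fewer than p / 2 elements. *)
pose D' : {set 'F_p} := ~: (0 |: D).
have D'0 : 0 \notin D' by rewrite !inE.
have D'n0 : D' != finset.set0.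
  apply/finset.set0Pn; exists (e' b' - e' a'); rewrite 2!inE negb_or ND andbT inE.
  by rewrite subr_eq0 (can_eq e'K) eq_sym.
have fD' g x d : g \in G -> d \in D' -> f g (x + d) - f g x \in D'.
  move=> Gg; rewrite !finset.in_setC !finset.in_setU1 !negb_or subr_eq0.
  rewrite (inj_eq (f_inj g)) -{2}[x]addr0 (inj_eq (addrI x)) => /andP[-> /=].
  apply: contraNN => dD.
  have := fD g^-1%g (f g x) _ _ dD; rewrite groupV => /(_ Gg).
  by rewrite [f g x + _]addrC subrK !fK [x + d]addrC addrK.
have cardD : (#|D| + #|D'|).+1 = p.
  by have := cardsC (0 |: D); rewrite cardsU1 D0 card_Fp // => <-.
have [D1 [D1n0 D10 D1p fD1]] : exists D1 : {set 'F_p}, [/\ D1 != finset.set0, 0 \notin D1,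
    (2 * #|D1| < p)%N & forall g x d, g \in G -> d \in D1 -> f g (x + d) - f g x \in D1].
  have [le|gt] := leqP #|D| #|D'|; first by exists D; split=> //; lia.
  by exists D'; split=> //; lia.
move=> g Gg g1.
have [u [v fE]] := affine_of_difference_set p_pr D1n0 D10 D1p (f_inj g)
  (fun x d => fD1 g x d Gg).
have fixE y : (g y == y) = (f g (e' y) == e' y) by rewrite /f e'K (can_eq e'K).
have -> : p = (#|moved g| + #|~: moved g|)%N by rewrite cardsC cardT.
(* An affine map with two fixed points is the identity. *)
rewrite -addn1 leq_add2l leqNgt; apply: contraNN g1 => /card_gt1P[y1 [y2 []]].
rewrite !inE !negbK !fixE !fE => /eqP h1 /eqP h2 y12; apply/eqP/permP => y.
have e12 : e' y1 - e' y2 != 0 by rewrite subr_eq0 (can_eq e'K).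
have u1 : u = 1.
  apply: (mulIf e12); rewrite mul1r -{2}h1 -{2}h2; ring.
have v0 : v = 0 by apply: (addrI (u * e' y1)); rewrite addr0 h1 u1 mul1r.
by rewrite perm1; apply/eqP; rewrite fixE fE u1 v0 mul1r addr0.
Qed.

End Burnside.

(** * Numerical contradiction and the resulting criterion for permutation groups *)

Lemma degree_bounds_absurd (n m s : nat) : prime n ->
    (s = 2 -> 10 < n)%N -> (s = 3 -> 23 < n)%N -> (3 < s -> 8 * s + 6 < n)%N ->
    (3 < m)%N -> (m <= 2 * s)%N -> (m <= n)%N -> (n.-1 <= m.-1 ^ 2)%N ->
    (3 * n.-1 + m * (n - m) <= 3 * m.-1 ^ 2 + 6 * (n - m))%N ->
  False.
Proof.
move=> n_pr h2 h3 h4 m3 ms mn b1 b2.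
(* The last bound rearranges to (m - 3) n <= 4 m (m - 3) + 6, whence n <= 4 m + 6 <= 8 s + 6. *)
have [s4|s4] := ltnP 3 s; first by have := h4 s4; clear -m3 ms mn b2; nia.
have [s3|s2] : s = 3 \/ s = 2 by lia.
  (* Here n - 1 <= 25, which leaves only 24, 25 and 26, none of them prime. *)
  have n23 := h3 s3; have m6 : (m <= 6)%N by lia.
  have n26 : (n <= 26)%N by clear -m6 m3 b1; case: m m6 m3 b1 => [|[|[|[|[|[|[|m]]]]]]] //=; lia.
  have : (n == 24) || (n == 25) || (n == 26) by lia.
  by case/orP=> [/orP[]|] /eqP nE; rewrite nE in n_pr.
have n10 := h2 s2; have mE : m = 4 by lia.
by move: b1; rewrite mE /=; lia.
Qed.

Theorem prime_degree_Alt (T : finType) (G : {group {perm T}}) (t : {perm T}) (s : nat) :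
    prime #|T| -> (forall x y, exists2 g, g \in G & g x = y) ->
    t \in G -> #|moved t| = (2 * s)%N -> (0 < s)%N -> (2 * s + 1 < #|T|)%N ->
    (s = 2 -> 10 < #|T|)%N -> (s = 3 -> 23 < #|T|)%N -> (3 < s -> 8 * s + 6 < #|T|)%N ->
  ('Alt_T \subset G)%g.
Proof.
move=> p_pr G_trans Gt mt s0 s_lt h2 h3 h4.
have t1 : t != 1%g.
  apply: contraTneq s0 => tE; move: mt; rewrite (_ : moved t = finset.set0) ?cards0 ?lt0n.
    by case: s {h2 h3 h4 s_lt}.
  by apply/setP => x; rewrite !inE tE perm1 eqxx.
have [G2|/(_ t Gt t1)] := transitive_prime_degree p_pr erefl G_trans; last first.
  by rewrite mt; lia.
pose P u := (u \in G) && (u != 1%g).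
have Pt : P t by rewrite /P Gt.
case: (arg_minnP (fun u => #|moved u|) Pt) => u /andP[Gu u1] umin.
have [m3|m3] := leqP #|moved u| 3; first exact: (Alt_sub_moved_le3 G2 Gu u1).
have le_m : (#|moved u| <= 2 * s)%N by rewrite -mt umin.
have u_min v : v \in G -> v != 1%g -> (#|moved u| <= #|moved v|)%N.
  by move=> Gv v1; apply: umin; rewrite /P Gv.
have [] := minimal_degree_bound G2 Gu u_min m3.
move=> b1 b2; have mn : (#|moved u| <= #|T|)%N by apply: max_card.
by have := degree_bounds_absurd p_pr h2 h3 h4 m3 le_m mn b1 b2.
Qed.

(** * Integer consequences of the logarithmic hypothesis *)

Section LogBounds.

Variable R : realType.

Lemma ln_ge_1subV (x : R) : 0 < x -> 1 - x^-1 <= ln x.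
Proof.
move=> x0; have := @le_ln1Dx R (x^-1 - 1).
rewrite [1 + _]addrC subrK lnV ?posrE // => H.
have xV0 : 0 < x^-1 by rewrite invr_gt0.
have /H : -1 < x^-1 - 1 by lra.
lra.
Qed.

(** Splitting into ratios closer to 1 sharpens [ln_ge_1subV]: 1/4 + 1/3 = 7/12. *)
Lemma ln2_ge : 7 / 12 <= ln (2 : R).
Proof.
have -> : (2 : R) = 4 / 3 * (3 / 2) by lra.
rewrite lnM ?posrE //; [|lra..].
have h1 : 1 - (4 / 3)^-1 <= ln (4 / 3 : R) by apply: ln_ge_1subV; lra.
have h2 : 1 - (3 / 2)^-1 <= ln (3 / 2 : R) by apply: ln_ge_1subV; lra.
lra.
Qed.

Lemma ln3_ge : 19 / 20 <= ln (3 : R).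
Proof.
(* Here 3 = (3/2)(4/3)(5/4)(6/5), and 1/3 + 1/4 + 1/5 + 1/6 = 19/20. *)
have e1 : ln (3 : R) = ln (3 / 2 * (4 / 3)) + ln (5 / 4 * (6 / 5)).
  by rewrite -lnM ?posrE; [congr ln; lra|lra..].
have e2 : ln (3 / 2 * (4 / 3) : R) = ln (3 / 2) + ln (4 / 3) by rewrite lnM ?posrE //; lra.
have e3 : ln (5 / 4 * (6 / 5) : R) = ln (5 / 4) + ln (6 / 5) by rewrite lnM ?posrE //; lra.
have h1 : 1 - (4 / 3)^-1 <= ln (4 / 3 : R) by apply: ln_ge_1subV; lra.
have h2 : 1 - (3 / 2)^-1 <= ln (3 / 2 : R) by apply: ln_ge_1subV; lra.
have h3 : 1 - (5 / 4)^-1 <= ln (5 / 4 : R) by apply: ln_ge_1subV; lra.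
have h4 : 1 - (6 / 5)^-1 <= ln (6 / 5 : R) by apply: ln_ge_1subV; lra.
lra.
Qed.

Lemma degree_lower_bounds (p s : nat) :
    s%:R * (s%:R * ln s%:R + 2 * ln s%:R + 3) <= p%:R :> R ->
  [/\ (s = 2 -> 10 < p)%N, (s = 3 -> 23 < p)%N & (3 < s -> 8 * s + 6 < p)%N].
Proof.
move=> sp; split=> [s2|s3|s4].
- rewrite ltnNge; apply/negP; rewrite -(ler_nat R) => p10.
  by move: sp p10; rewrite s2; have := ln2_ge; lra.
- rewrite ltnNge; apply/negP; rewrite -(ler_nat R) => p23.
  by move: sp p23; rewrite s3; have := ln3_ge; lra.
rewrite ltnNge; apply/negP; rewrite -(ler_nat R) natrD natrM => p8.
have s4R : 4 <= s%:R :> R by rewrite (ler_nat R 4).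
have l4 : 7 / 6 <= ln s%:R :> R.
  apply: (@le_trans _ _ (ln (2 * 2))); last by rewrite ler_ln ?posrE //; lra.
  by rewrite lnM ?posrE //; have := ln2_ge; lra.
have key (l x y : R) : 4 <= x -> 7 / 6 <= l ->
    x * (x * l + 2 * l + 3) <= y -> y <= 8 * x + 6 -> False.
  move=> x4 l_ge xy yx.
  (* The constant is (4 + 2) (7 / 6) + 3 = 10, and 10 x > 8 x + 6 for x >= 4. *)
  have : x * 10 <= x * (x * l + 2 * l + 3) by rewrite ler_pM2l; nra.
  by lra.
exact: key s4R l4 sp p8.
Qed.

End LogBounds.

(** * Galois groups as permutation groups *)

Section EmbeddingInClosedField.

Variables (L : splittingFieldType rat) (C : numClosedFieldType).

Lemma exists_primitive_element : exists a : L,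
  forall x : L, exists q : {poly rat}, x = (map_poly (in_alg L) q).[a].
Proof.
have sepL : separable 1 {:L}.
  apply/separableP => x _; apply: pcharf0_separable => i.
  by rewrite pchar_lalg pchar_num.
have gen := eq_adjoin_separable_generator sepL (subvf _).
exists (separable_generator 1 {:L}) => x.
have : x \in <<1; separable_generator 1 {:L}>>%VS by rewrite -gen memvf.
by case/Fadjoin_polyP => _ /polyOver1P[q ->] ->; exists q.
Qed.

Lemma minPoly_rat (a : L) : exists2 P : {poly rat},
  map_poly (in_alg L) P = minPoly 1 a & forall q : {poly rat},
    (map_poly (in_alg L) q).[a] = 0 -> P %| q.
Proof.
have /polyOver1P[P PE] := minPolyOver 1 a; exists P; first by rewrite PE.
move=> q qa; rewrite -(dvdp_map (in_alg L)) -PE; apply: minPoly_dvdp.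
  by apply/polyOver1P; exists q.
exact/rootP.
Qed.

Lemma rmorph_in_alg (phi : {rmorphism L -> C}) (q : {poly rat}) :
  map_poly phi (map_poly (in_alg L) q) = map_poly ratr q.
Proof.
by rewrite -map_poly_comp; apply: eq_map_poly => x; rewrite (fmorph_eq_rat (phi \o in_alg L)).
Qed.

(** A primitive element [a] is sent to a root [b] of its minimal polynomial. The value at q(a) is
    q(b) for any choice of q, since that polynomial divides every q vanishing at [a]. *)
Lemma exists_embedding : inhabited {rmorphism L -> C}.
Proof.
have [a prim] := exists_primitive_element.
have [P PE Pdvd] := minPoly_rat a.
have [b Pb] : exists b : C, root (map_poly ratr P) b.
  apply/closed_rootP; rewrite size_map_poly -(size_map_poly (in_alg L)) PE.
  by rewrite size_minPoly eqSS -lt0n.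
have eval (q : {poly rat}) : (map_poly (in_alg L) q).[a] = 0 -> (map_poly ratr q).[b] = 0 :> C.
  by move=> /Pdvd/dvdpP[m ->]; rewrite rmorphM hornerM /= (rootP Pb) mulr0.
have [rep repE] := choice prim.
pose f x : C := (map_poly ratr (rep x)).[b].
have fE (q : {poly rat}) x : x = (map_poly (in_alg L) q).[a] -> f x = (map_poly ratr q).[b].
  move=> xq; apply/eqP; rewrite -subr_eq0 -hornerN -hornerD -rmorphN -rmorphD /=.
  by apply/eqP/eval; rewrite rmorphB hornerD hornerN -repE xq subrr.
have f_add : zmod_morphism f.
  move=> x y; rewrite (fE (rep x - rep y)) ?rmorphB ?hornerD ?hornerN //=.
  by rewrite -!repE.
have f_mul : monoid_morphism f.
  split; first by rewrite (fE 1) ?rmorph1 ?hornerC.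
  by move=> x y; rewrite (fE (rep x * rep y)) ?rmorphM ?hornerM //= -!repE.
pose fZ := GRing.isZmodMorphism.Build L C f f_add.
pose fM := GRing.isMonoidMorphism.Build L C f f_mul.
by split; exact: (HB.pack f fZ fM : {rmorphism L -> C}).
Qed.

(** The minimal polynomial of a primitive [a] is rational and splits in [L], so [psi a] is [phi b]
    for a conjugate b of [a]; the automorphism sending [a] to b works. *)
Lemma embeddings_conjugate (phi psi : {rmorphism L -> C}) :
  exists2 g, g \in 'Gal({:L} / 1)%g & forall x, phi (g x) = psi x.
Proof.
have [a prim] := exists_primitive_element.
have [r] := normalFieldP (normalFieldf 1) a (memvf a) => _ rE.
have : root (map_poly psi (minPoly 1 a)) (psi a).
  by rewrite fmorph_root root_minPoly.
have [P PE _] := minPoly_rat a.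
rewrite -PE rmorph_in_alg -(rmorph_in_alg phi) PE rE.
rewrite rmorph_prod (eq_bigr (fun b => 'X - (phi b)%:P)) => [|b _]; last first.
  by rewrite rmorphB /= map_polyX map_polyC.
rewrite -(big_map phi xpredT (fun c => 'X - c%:P)) root_prod_XsubC => /mapP[b br ab].
have [g Gg ga] : exists2 g, g \in 'Gal({:L} / 1)%g & g a = b.
  apply: normalField_root_minPoly; rewrite ?subvf ?normalFieldf ?memvf //.
  by rewrite rE root_prod_XsubC.
exists g => // x; have [q ->] := prim x.
have gq (h : {rmorphism L -> L}) y : h (map_poly (in_alg L) q).[y] = (map_poly (in_alg L) q).[h y].
  rewrite -horner_map /= -map_poly_comp; congr (_.[_]).
  by apply: eq_map_poly => z; rewrite (fmorph_eq_rat (h \o in_alg L)) (fmorph_eq_rat (in_alg L)).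
rewrite gq -[LHS]horner_map -[RHS]horner_map !rmorph_in_alg.
congr (_.[_]); rewrite ab; congr (phi _); exact: ga.
Qed.

End EmbeddingInClosedField.

Lemma card_eq_uniq_seq (T : choiceType) (l : seq T) :
  uniq l -> ([set z | z \in l]%classic #= `I_(size l))%card.
Proof.
case: l => [|x0 l0] ul.
  have -> : [set z | z \in Nil T]%classic = classical_sets.set0 by apply/seteqP; split.
  by rewrite II0 card_eq00.
set l := x0 :: l0 in ul *.
have -> : [set z | z \in l]%classic = (nth x0 l @` `I_(size l))%classic.
  apply/seteqP; split=> z /=; first by case/(nthP x0) => i il <-; exists i.
  by case=> i il <-; apply: mem_nth.
by apply: inj_card_eq => i j; rewrite !in_setE /= => il jl /eqP; rewrite nth_uniq // => /eqP.
Qed.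

(** * The Galois group acting on the labelled roots *)

Section GaloisPermutations.

Variables (L : splittingFieldType rat) (f : {poly rat}) (n : nat) (rs : n.-tuple L).
Hypotheses (f_irr : irreducible_poly f) (rs_roots : root_labelling f rs).

Lemma gal_permP (s : 'S_n) : reflect
  (exists2 g, g \in 'Gal({:L} / 1)%g & forall i, g (tnth rs i) = tnth rs (s i))
  (s \in gal_perm rs).
Proof.
rewrite inE; apply: (iffP exists_inP) => -[g Gg gs]; exists g => //.
  by move=> i; apply/eqP; apply: (forallP gs).
by apply/forallP => i; apply/eqP; apply: gs.
Qed.

Lemma gal_perm_group_set : group_set (gal_perm rs).
Proof.
apply/group_setP; split.
  apply/gal_permP; exists (1%g : gal_of {:L}%VS) => [|i].
    exact: group1.
  by rewrite perm1 gal_id.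
move=> s t /gal_permP[g Gg gs] /gal_permP[h Gh ht]; apply/gal_permP.
exists (g * h)%g => [|i]; first exact: groupM.
by rewrite galM ?memvf // gs ht permM.
Qed.

Canonical gal_perm_group := Group gal_perm_group_set.

Lemma tnth_labelling_inj : injective (tnth rs).
Proof. by case: rs_roots => u _; apply/tuple_uniqP. Qed.

Lemma exists_gal_perm g : g \in 'Gal({:L} / 1)%g ->
  exists2 s, s \in gal_perm rs & forall i, g (tnth rs i) = tnth rs (s i).
Proof.
move=> Gg; have [_ rsE] := rs_roots.
have gi i : exists j, g (tnth rs i) = tnth rs j.
  apply/tnthP; rewrite rsE; have := rsE (tnth rs i); rewrite mem_tnth => /esym.
  have gf : map_poly g (map_poly (in_alg L) f) = map_poly (in_alg L) f.
    rewrite -map_poly_comp; apply: eq_map_poly => z.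
    by rewrite (fmorph_eq_rat (g \o in_alg L)) (fmorph_eq_rat (in_alg L)).
  by rewrite -{2}gf fmorph_root.
have [s0 s0E] := choice gi.
have s0_inj : injective s0.
  move=> i j ij; apply: tnth_labelling_inj.
  have : g (tnth rs i) = g (tnth rs j) by rewrite !s0E ij.
  exact: fmorph_inj.
exists (perm s0_inj) => [|i]; last by rewrite permE.
by apply/gal_permP; exists g => // i; rewrite permE.
Qed.

(** An irreducible [f] is associate to the minimal polynomial of each of its roots, and
    automorphisms of a normal extension link any two roots of it. *)
Lemma gal_perm_transitive i j : exists2 s, s \in gal_perm_group & s i = j.
Proof.
have [_ rsE] := rs_roots.
have [P PE Pdvd] := minPoly_rat (tnth rs i).
have rf k : root (map_poly (in_alg L) f) (tnth rs k) by rewrite -rsE mem_tnth.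
have Pf : P %= f.
  apply: f_irr.2; last by apply: Pdvd; apply/rootP.
  by rewrite -(size_map_poly (in_alg L)) PE size_minPoly eqSS -lt0n.
have [g Gg gij] : exists2 g, g \in 'Gal({:L} / 1)%g & g (tnth rs i) = tnth rs j.
  apply: normalField_root_minPoly; rewrite ?subvf ?normalFieldf ?memvf //.
  by rewrite -PE (eqp_root (q := map_poly (in_alg L) f)) ?eqp_map.
have [s Gs sE] := exists_gal_perm Gg; exists s => //.
by apply: tnth_labelling_inj; rewrite -sE.
Qed.

(** Conjugation after an embedding [phi] is another embedding, hence [phi] after some automorphism
    [g]. That [g] moves exactly the roots with non-real image. *)
Lemma complex_conjugation_moved (R : realType) (r : nat) :
    f != 0 -> (nonreal_roots R f #= `I_r)%card ->
    splittingFieldFor 1 (map_poly (in_alg L) f) {:L} ->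
  exists2 t, t \in gal_perm_group & #|moved t| = r.
Proof.
move=> f0 card_r [rs' f_split _].
have [phi] := exists_embedding L R[i].
pose psi : {rmorphism L -> R[i]} := [the {rmorphism R[i] -> R[i]} of conjc] \o phi.
have [g Gg gE] := embeddings_conjugate phi psi.
have [t Gt tE] := exists_gal_perm Gg; exists t => //.
have [_ rsE] := rs_roots.
have conj_fix (z : R[i]) : (conjc z == z) = (complex.Im z == 0).
  case: z => a b /=; rewrite eq_complex /= eqxx /= -subr_eq0 -opprD oppr_eq0.
  by rewrite -mulr2n mulrn_eq0.
have movedE i : (i \in moved t) = (complex.Im (phi (tnth rs i)) != 0).
  rewrite inE -conj_fix -(inj_eq tnth_labelling_inj) -tE -(inj_eq (fmorph_inj phi)).
  by rewrite gE.
(* As [f] splits in [L], every complex root comes from a labelled root. *)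
have rootE z : root (map_poly ratr f) z <-> exists i, z = phi (tnth rs i).
  rewrite -(rmorph_in_alg phi); split=> [|[i ->]]; last first.
    by rewrite fmorph_root -rsE mem_tnth.
  have /eqpP[[c d] /= /andP[c0 d0] cd] := f_split => rz.
  have : root (map_poly phi (\prod_(b <- rs') ('X - b%:P))) z.
    rewrite -(rootZ _ _ (_ : phi d != 0)) ?fmorph_eq0 // -map_polyZ /= -cd.
    by rewrite map_polyZ rootZ ?fmorph_eq0.
  rewrite rmorph_prod (eq_bigr (fun b => 'X - (phi b)%:P)) => [|b _]; last first.
    by rewrite rmorphB /= map_polyX map_polyC.
  rewrite -(big_map phi xpredT (fun c => 'X - c%:P)) root_prod_XsubC => /mapP[b br ->].
  have : root (map_poly (in_alg L) f) b by rewrite (eqp_root f_split) root_prod_XsubC.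
  by rewrite -rsE => /tnthP[i ->]; exists i.
pose l := [seq phi (tnth rs i) | i <- enum (moved t)].
have l_uniq : uniq l.
  rewrite map_inj_uniq ?enum_uniq // => i j /fmorph_inj.
  exact: tnth_labelling_inj.
have nonrealE : nonreal_roots R f = [set z | z \in l]%classic.
  apply/seteqP; split=> z /=.
    case=> /rootE[i ->] imz; apply/mapP; exists i => //.
    by rewrite mem_enum movedE.
  case/mapP => i; rewrite mem_enum movedE => imz ->; split=> //.
  by apply/rootE; exists i.
apply/card_eq_II; apply: card_eq_trans card_r; rewrite nonrealE card_eq_sym.
by rewrite cardE -(size_map (fun i => phi (tnth rs i))) card_eq_uniq_seq.
Qed.

End GaloisPermutations.

Theorem theorem3 (R : realType) (f : {poly rat}) (p s : nat)
    (f_irr : irreducible_poly f) (p_prime : prime p) (p_ge5 : (5 <= p)%N)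
    (f_deg : size f = p.+1)
    (s_ge1 : (1 <= s)%N) (f_nonreal : (nonreal_roots R f #= `I_(2 * s))%card)
    (s_bound : s%:R * (s%:R * ln s%:R + 2 * ln s%:R + 3) <= p%:R :> R)
    (L : splittingFieldType rat)
    (L_split : splittingFieldFor 1 (map_poly (in_alg L) f) {:L})
    (rs : p.-tuple L) (rs_roots : root_labelling f rs) :
  gal_perm rs = ('Alt_('I_p))%g \/ gal_perm rs = ('Sym_('I_p))%g.
Proof.
have f0 : f != 0 by rewrite -size_poly_eq0 f_deg.
have [t Gt mt] := complex_conjugation_moved rs_roots f0 f_nonreal L_split.
have [h2 h3 h4] := degree_lower_bounds s_bound.
apply: (@Alt_sub_eq _ (gal_perm_group rs)).
(* The inequality 2 s + 1 < p comes from p >= 5 when s = 1 and from the three bounds otherwise. *)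
apply: (prime_degree_Alt _ _ Gt mt s_ge1); rewrite ?card_ord //; last by lia.
exact: (gal_perm_transitive f_irr rs_roots).
Qed.
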